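(* Every $3$-colorable graph is word-representable.
   Context: Graphs are finite, simple and undirected. A graph is $3$-colorable if it has a proper vertex coloring with at most three colors. Two distinct letters $x,y$ alternate in a word $W$ if the word obtained from $W$ by deleting all letters other than $x$ and $y$ contains neither $xx$ nor $yy$ as a factor (two consecutive letters). A word $W$ represents a graph $G=(V,E)$ if the set of letters occurring in $W$ is $V$ (every vertex occurs at least once) and, for all distinct $x,y\in V$, $xy\in E$ if and only if $x$ and $y$ alternate in $W$. $G$ is word-representable if some word represents it. *)

(* Defs.v *)
(* A finite simple graph is a symmetric irreflexive relation
   [e : rel V] on a finite type [V] of vertices; these two properties are
   hypotheses of the theorem. A word over [V] is a [seq V]. *)
From mathcomp Require Export all_boot.

Set Implicit Arguments.
Unset Strict Implicit.
Unset Printing Implicit Defensive.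

Section WordRepresentability.

Variable V : finType.
Implicit Types (e : rel V) (w : seq V) (x y : V).

(* The colouring need not be surjective, so this means "at most k colours". *)
Definition colorable (k : nat) e : Prop :=
  exists c : V -> 'I_k, forall x y, e x y -> c x != c y.

Definition restrict_word x y w : seq V :=
  [seq z <- w | (z == x) || (z == y)].

(* [infix u w] says that u is a factor of w, i.e. a contiguous subword.
   Only meaningful for x != y. *)
Definition alternate x y w : bool :=
  ~~ infix [:: x; x] (restrict_word x y w) &&
  ~~ infix [:: y; y] (restrict_word x y w).

Definition represents w e : Prop :=
  (forall x, x \in w) /\
  (forall x y, x != y -> e x y = alternate x y w).

Definition word_representable e : Prop := exists w, represents w e.

End WordRepresentability.

(* Main.v *)
Require Import Defs.
From mathcomp Require Import all_boot.
From mathcomp Require Import zify.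

Set Implicit Arguments.
Unset Strict Implicit.
Unset Printing Implicit Defensive.

(** Let the colours be 0, 1, 2 and orient every edge [x y] from the smaller
colour to the larger one. Call a word in phase with the edge when its
restriction to [x] and [y] is [xyxy...xy]. Such a word makes [x] and [y]
alternate, and words in phase with an edge can be concatenated. So it suffices
to find, for each pair of distinct non-adjacent vertices [p], [q] with
[c p <= c q], a word in phase with every edge whose restriction to [p] and [q]
contains a square [pp] or [qq]: the concatenation of all these words then
represents the graph (a listing of all the vertices is put in front, so that
every letter occurs even when there is no such pair).

If [c q <= c p + 1], no directed path of length at least 2 joins [p] to [q],
so [p] and [q] can be made consecutive in a linear order of the vertices that
is compatible with the orientation. The order [X p q Y], where [X] lists the
other vertices of colour at most [c p] and [Y] those of larger colour, both
sorted by colour, is one; as [p] and [q] are not adjacent, [X q p Y] is another.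
Concatenating the two produces [pqqp] ([separator_near]).

Otherwise [c p = 0] and [c q = 2], and [p] may have to precede [q] in every
compatible order because of a path through colour 1. But [p] is a source and
[q] a sink. In two consecutive copies of a listing [K] sorted by colour, the
second [p] may therefore move left to the end of the first copy, and the first
[q] may move right to the beginning of the second copy, without disturbing any
edge, since the edge [p q] is absent. The resulting word
[(K - q) p q (K - p)] restricts to [ppqq] ([separator_far]). Three is the
largest number of colours for which [c q > c p + 1] forces [p] to be a source
and [q] a sink. *)

(** * Alternation and words in phase with an edge *)

Section Phase.

Variable V : finType.
Implicit Types (x y : V) (u v w : seq V).

Definition in_phase x y w : Prop :=
  exists k, restrict_word x y w = flatten (nseq k [:: x; y]).

Lemma restrict_word_cat x y u v :
  restrict_word x y (u ++ v) = restrict_word x y u ++ restrict_word x y v.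
Proof. exact: filter_cat. Qed.

Lemma alternateC x y w : alternate x y w = alternate y x w.
Proof.
rewrite /alternate andbC; suff -> : restrict_word x y w = restrict_word y x w by [].
by apply: eq_filter => z; rewrite orbC.
Qed.

Lemma in_phase_cat x y u v :
  in_phase x y u -> in_phase x y v -> in_phase x y (u ++ v).
Proof.
move=> [k uk] [l vl]; exists (k + l).
by rewrite restrict_word_cat uk vl nseqD flatten_cat.
Qed.

Lemma in_phase_flatten x y (ws : seq (seq V)) :
  (forall w, w \in ws -> in_phase x y w) -> in_phase x y (flatten ws).
Proof.
elim: ws => [|w ws IHws] ws_phase; first by exists 0.
apply: in_phase_cat; first by apply: ws_phase; rewrite mem_head.
by apply: IHws => v v_ws; apply: ws_phase; rewrite in_cons v_ws orbT.
Qed.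

Lemma in_phase_alternate x y w : x != y -> in_phase x y w -> alternate x y w.
Proof.
move=> /negPf xDy [k]; rewrite /alternate => ->.
have yDx : (y == x) = false by rewrite eq_sym.
elim: k => [|k /andP[/negPf noxx /negPf noyy]] //=.
(* The only factor [yy] that the new pair could create straddles the junction. *)
rewrite xDy yDx noxx noyy !eqxx !andbF /= !orbF.
by case: k {noxx noyy} => //= k; rewrite yDx.
Qed.

Lemma alternate_factor x y u v w :
  alternate x y (u ++ v ++ w) -> alternate x y v.
Proof.
rewrite /alternate !restrict_word_cat => /andP[noxx noyy].
apply/andP; split; [move: noxx | move: noyy]; apply: contraNN => vsq;
  exact/infix_catl/infix_catr.
Qed.

End Phase.

(** * Listing the vertices by colour *)

Section ColorSort.

Variables (V : finType) (c : V -> nat).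
Implicit Types (x y p q : V) (P : pred V).

Definition by_color : seq V := sort (relpre c leq) (enum V).

Lemma mem_by_color x : x \in by_color.
Proof. by rewrite mem_sort mem_enum. Qed.

Lemma restrict_by_color x y :
  c x < c y -> restrict_word x y by_color = [:: x; y].
Proof.
move=> cxy; set s := restrict_word x y by_color.
have xDy : x != y by apply: contraTneq cxy => ->; rewrite ltnn.
have s_perm : perm_eq s [:: x; y].
  apply: uniq_perm => [||z]; last by rewrite mem_filter mem_by_color andbT !inE.
    by rewrite filter_uniq // sort_uniq enum_uniq.
  by rewrite /= inE xDy.
have s_sorted : sorted (relpre c leq) s.
  apply: sorted_filter; first by move=> ? ? ?; apply: leq_trans.
  by apply: sort_sorted => ? ?; apply: leq_total.
move: s_perm s_sorted (perm_size s_perm) (perm_mem s_perm).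
case: s => [|a [|b [|? ?]]] //= s_perm s_sorted _ s_mem.
have := perm_uniq s_perm; rewrite /= !inE xDy !andbT => aDb.
have := s_mem a; have := s_mem b; rewrite !inE !eqxx orbT /=.
case/esym/pred2P=> ? /esym/pred2P[] ?; subst=> //; rewrite ?eqxx // in aDb.
by rewrite andbT leqNgt cxy in s_sorted.
Qed.

(** Reduces the restriction of any sublist of the colour listing to a
computation on two letters. *)
Lemma restrict_filter_by_color x y P : c x < c y ->
  restrict_word x y [seq z <- by_color | P z] = [seq z <- [:: x; y] | P z].
Proof.
move=> cxy; rewrite -(restrict_by_color cxy) /restrict_word -!filter_predI.
by apply: eq_filter => z; rewrite /= andbC.
Qed.

Lemma restrict_filter_nil x y P (s : seq V) : ~~ P x -> ~~ P y ->
  restrict_word x y [seq z <- s | P z] = [::].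
Proof.
move=> nPx nPy; rewrite /restrict_word -filter_predI.
apply/eqP; rewrite -[_ == _]negbK -has_filter; apply/hasPn => z _ /=.
by apply/negP => /andP[/pred2P[] ->]; apply/negP.
Qed.

(** * Separating a non-adjacent pair *)

Definition below p q : seq V :=
  [seq z <- by_color | [&& z != p, z != q & c z <= c p]].
Definition above p q : seq V :=
  [seq z <- by_color | [&& z != p, z != q & c p < c z]].

Definition separator p q : seq V :=
  if c q <= (c p).+1 then
    (below p q ++ [:: p; q] ++ above p q) ++
    (below p q ++ [:: q; p] ++ above p q)
  else [seq z <- by_color | z != q] ++ [:: p; q] ++ [seq z <- by_color | z != p].

(** As [c q <= c p + 1], a vertex of colour smaller than [c q] has colour at
most [c p]. So each neighbour of [p] or [q] outside the pair is already on the
side of the cut that the orientation requires, and the order in which the two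
are listed at the cut is free. *)
Lemma separator_near p q r s x y :
  p != q -> c p <= c q <= (c p).+1 -> (r, s) \in [:: (p, q); (q, p)] ->
  c x < c y -> ~~ ((x == p) && (y == q)) ->
  in_phase x y (below p q ++ [:: r; s] ++ above p q).
Proof.
move=> pDq /andP[cpq cqp] rs cxy nxy; exists 1.
rewrite !restrict_word_cat !restrict_filter_by_color //=.
move: rs nxy; rewrite !inE => /pred2P[] [-> ->];
  rewrite ?(eq_sym p x) ?(eq_sym p y) ?(eq_sym q x) ?(eq_sym q y);
  move/eqP: pDq => pDq;
  case: (x =P p) => ?; case: (x =P q) => ?; case: (y =P p) => ?;
  case: (y =P q) => ? //=; do ?[case: leqP => ? //=]; subst; by [lia | congruence].
Qed.

(** No edge enters [p], so an edge [p y] only needs the second [p] to come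
between the two [y]s; dually, an edge [x q] only needs the first [q] to come
between the two [x]s. This leaves both letters free to meet at the junction of
the two copies of the listing. *)
Lemma separator_far p q x y :
  (forall z, c p <= c z <= c q) ->
  c x < c y -> ~~ ((x == p) && (y == q)) ->
  in_phase x y
    ([seq z <- by_color | z != q] ++ [:: p; q] ++ [seq z <- by_color | z != p]).
Proof.
move=> cpq cxy nxy.
have [/andP[cpx _] /andP[_ cyq]] := (cpq x, cpq y).
have xDq : (x == q) = false by apply: contraTF cxy => /eqP ->; lia.
have yDp : (y == p) = false by apply: contraTF cxy => /eqP ->; lia.
exists 2; rewrite !restrict_word_cat !restrict_filter_by_color //=.
rewrite (eq_sym p x) (eq_sym p y) (eq_sym q x) (eq_sym q y) xDq yDp /=.
by case: (x =P p) nxy => [->|_]; case: (y =P q) => [->|_].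
Qed.

Lemma separator_not_alternate p q :
  p != q -> c p <= c q -> ~~ alternate p q (separator p q).
Proof.
move=> pDq cpq; rewrite /alternate /separator; case: ifP => [_ | cqp].
  rewrite !restrict_word_cat !restrict_filter_nil ?eqxx ?andbF //=.
  by rewrite !eqxx !orbT /= !eqxx /= !orbT andbF.
have cpDq : c p < c q by lia.
rewrite !restrict_word_cat !restrict_filter_by_color //=.
by rewrite !eqxx pDq (eq_sym q) pDq !orbT /= !eqxx /= ?orbT.
Qed.

End ColorSort.

Theorem corollary3 (V : finType) (e : rel V)
    (e_sym : symmetric e) (e_irr : irreflexive e) :
  colorable 3 e -> word_representable e.
Proof.
move=> [col col_proper]; pose c z := nat_of_ord (col z).
pose pairs := [seq pq <- enum {: V * V} |
  [&& pq.1 != pq.2, c pq.1 <= c pq.2 & ~~ e pq.1 pq.2]].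
pose w := by_color c ++ flatten [seq separator c pq.1 pq.2 | pq <- pairs].
have edge_alt x y : e x y -> c x < c y -> alternate x y w.
  move=> exy cxy; have xDy : x != y by apply: contraTneq cxy => ->; rewrite ltnn.
  apply: in_phase_alternate => //; apply: in_phase_cat.
    by exists 1; rewrite restrict_by_color.
  apply: in_phase_flatten => _ /mapP[[p q] + ->].
  rewrite mem_filter /= => /andP[/and3P[pDq cpq nepq] _].
  have nxy : ~~ ((x == p) && (y == q)).
    by apply: contraNN nepq => /andP[/eqP <- /eqP <-].
  rewrite /separator; case: ifP => cqp.
    by apply: in_phase_cat; apply: separator_near; rewrite ?cpq // !inE eqxx ?orbT.
  apply: separator_far => // z.
  have := ltn_ord (col z); have := ltn_ord (col q); rewrite /c in cqp *; lia.
have nonedge_nalt x y :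
    x != y -> ~~ e x y -> c x <= c y -> ~~ alternate x y w.
  move=> xDy nexy cxy; apply: contraNN (separator_not_alternate xDy cxy).
  have xy_pairs : (x, y) \in pairs by rewrite mem_filter /= xDy cxy nexy mem_enum.
  rewrite /w; case/splitPr: xy_pairs => s1 s2.
  rewrite map_cat flatten_cat /= catA; exact: alternate_factor.
exists w; split=> [x | x y xDy]; first by rewrite mem_cat mem_by_color.
wlog cxy : x y xDy / c x <= c y.
  by case/orP: (leq_total (c x) (c y)) => cxy hw;
    [|rewrite e_sym alternateC]; apply: hw; rewrite // eq_sym.
case: (boolP (e x y)) => [exy | nexy]; apply/esym; last first.
  exact/negbTE/nonedge_nalt.
apply: edge_alt => //; rewrite ltn_neqAle cxy andbT; exact: col_proper.
Qed.
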